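(* For all integers $m,n\ge 0$, the recursively defined polynomials $\alpha^{(m,n)},\beta^{(m,n)},c^{(m,n)}_0,\ldots,c^{(m,n)}_{m+n}\in S^{(m,n)}$ given in the context satisfy $$1=\alpha^{(m,n)}a^{(m)}+\beta^{(m,n)}b^{(n)}+\sum_{k=0}^{m+n}c^{(m,n)}_k\,C^{(m,n)}_k$$ in $S^{(m,n)}$.
   Context: For integers $m,n\ge 0$ let $S^{(m,n)}=\mathbb{Z}[a_0,\ldots,a_m,b_0,\ldots,b_n,A_0,\ldots,A_m,B_0,\ldots,B_n]$, a polynomial ring over $\mathbb{Z}$; for $m'\le m$, $n'\le n$ regard $S^{(m',n')}$ as a subring of $S^{(m,n)}$ in the obvious way. In $S^{(m,n)}$ define $$a^{(m)}=1-\sum_{i=0}^m a_iA_i,\qquad b^{(n)}=1-\sum_{j=0}^n b_jB_j,\qquad C^{(m,n)}_k=\sum_{\substack{i+j=k\\0\le i\le m,\ 0\le j\le n}}A_iB_j\quad(0\le k\le m+n).$$ The polynomials $\alpha^{(m,n)},\beta^{(m,n)},c^{(m,n)}_k$ ($0\le k\le m+n$) are defined recursively as follows. Initial conditions. For $m=0$ and $n\ge 0$: $\alpha^{(0,n)}=1$, $\beta^{(0,n)}=a_0A_0$, $c^{(0,n)}_k=a_0b_k$ for $0\le k\le n$. For $n=0$ and $m\ge 1$: $\alpha^{(m,0)}=b_0B_0$, $\beta^{(m,0)}=1$, $c^{(m,0)}_k=a_kb_0$ for $0\le k\le m$. (When $m=n=0$ the first set of formulas is used.) Recursion. For $m,n\ge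 1$, define auxiliary polynomials (depending on $(m,n)$) $$d=b_n\beta^{(m,n-1)}-\sum_{k=n}^{m+n-1}c^{(m,n-1)}_kA_{k-n},\qquad e=a_m\alpha^{(m-1,n)}-\sum_{k=m}^{m+n-1}c^{(m-1,n)}_kB_{k-m},$$ and set $$\alpha^{(m,n)}=\alpha^{(m,n-1)}+B_n\,d\,\alpha^{(m-1,n)},\qquad \beta^{(m,n)}=\beta^{(m,n-1)}+B_n\,d\,\beta^{(m-1,n)},$$ $$c^{(m,n)}_k=c^{(m,n-1)}_k+B_n\,d\,c^{(m-1,n)}_k\quad(0\le k\le m+n-1),\qquad c^{(m,n)}_{m+n}=d\,e.$$ *)

(* Defs.v *)
From HB Require Import structures.
From mathcomp Require Import all_boot all_order all_algebra.
From mathcomp Require Export mpoly.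

Set Implicit Arguments.
Unset Strict Implicit.
Unset Printing Implicit Defensive.

Import GRing.Theory.
Local Open Scope ring_scope.

(* S^(m,n) = Z[a_0..a_m, b_0..b_n, A_0..A_m, B_0..B_n], the indeterminates
   being listed in this order. *)
Notation polyS m n := {mpoly int[(m.+1 + n.+1) + (m.+1 + n.+1)]}.

Definition va m n (i : 'I_m.+1) : polyS m n := 'X_(lshift _ (lshift _ i)).
Definition vb m n (j : 'I_n.+1) : polyS m n := 'X_(lshift _ (rshift _ j)).
Definition vA m n (i : 'I_m.+1) : polyS m n := 'X_(rshift _ (lshift _ i)).
Definition vB m n (j : 'I_n.+1) : polyS m n := 'X_(rshift _ (rshift _ j)).

Definition incl_var m' n' m n (lem : (m' <= m)%N) (len : (n' <= n)%N)
    (x : 'I_((m'.+1 + n'.+1) + (m'.+1 + n'.+1))) : polyS m n :=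
  match split x with
  | inl y => match split y with
             | inl i => va n (widen_ord (lem : m'.+1 <= m.+1)%N i)
             | inr j => vb m (widen_ord (len : n'.+1 <= n.+1)%N j)
             end
  | inr y => match split y with
             | inl i => vA n (widen_ord (lem : m'.+1 <= m.+1)%N i)
             | inr j => vB m (widen_ord (len : n'.+1 <= n.+1)%N j)
             end
  end.

(* The inclusion S^(m',n') -> S^(m,n) for m' <= m and n' <= n: the ring morphism
   sending each indeterminate to the indeterminate of the same name. *)
Definition incl m' n' m n (lem : (m' <= m)%N) (len : (n' <= n)%N) (p : polyS m' n') :
    polyS m n :=
  comp_mpoly [tuple incl_var lem len x | x < (m'.+1 + n'.+1) + (m'.+1 + n'.+1)] p.

Definition pa m n : polyS m n := 1 - \sum_(i < m.+1) va n i * vA n i.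

Definition pb m n : polyS m n := 1 - \sum_(j < n.+1) vb m j * vB m j.

Definition pC m n (k : nat) : polyS m n :=
  \sum_(i < m.+1) \sum_(j < n.+1 | (i + j == k)%N) vA n i * vB m j.

(* The triple (alpha^(m,n), beta^(m,n), (c^(m,n)_k)_k). The values of the third
   component are meaningful only for k <= m + n. *)
Record coefs m n := Coefs {
  alpha_of : polyS m n;
  beta_of : polyS m n;
  c_of : nat -> polyS m n
}.

Definition coefs_0n n : coefs 0 n :=
  Coefs 1 (va n ord0 * vA n ord0) (fun k => va n ord0 * vb 0 (inord k)).

Definition coefs_m0 m : coefs m 0 :=
  Coefs (vb m ord0 * vB m ord0) 1 (fun k => va 0 (inord k) * vb m ord0).

(* One step of the recursion, producing the triple of index (m, n) with
   m := m1.+1 and n := n1.+1 from those of indices (m, n - 1) and (m - 1, n). *)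
Definition coefs_step m1 n1 (X : coefs m1.+1 n1) (Y : coefs m1 n1.+1) :
    coefs m1.+1 n1.+1 :=
  let m := m1.+1 in
  let n := n1.+1 in
  let iX : polyS m n1 -> polyS m n := incl (leqnn m) (leqnSn n1) in
  let iY : polyS m1 n -> polyS m n := incl (leqnSn m1) (leqnn n) in
  let d : polyS m n := vb m ord_max * iX (beta_of X)
           - \sum_(n <= k < m + n) iX (c_of X k) * vA n (inord (k - n)) in
  let e : polyS m n := va n ord_max * iY (alpha_of Y)
           - \sum_(m <= k < m + n) iY (c_of Y k) * vB m (inord (k - m)) in
  let Bn : polyS m n := vB m ord_max in
  Coefs (iX (alpha_of X) + Bn * d * iY (alpha_of Y))
        (iX (beta_of X) + Bn * d * iY (beta_of Y))
        (fun k => if (k < m + n)%N then iX (c_of X k) + Bn * d * iY (c_of Y k)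
                  else d * e).

Fixpoint coefs_rec m : forall n, coefs m n :=
  match m with
  | 0 => coefs_0n
  | m1.+1 => fix coefs_m n : coefs m1.+1 n :=
      match n with
      | 0 => coefs_m0 m1.+1
      | n1.+1 => coefs_step (coefs_m n1) (coefs_rec m1 n1.+1)
      end
  end.

Definition alpha m n : polyS m n := alpha_of (coefs_rec m n).
Definition beta m n : polyS m n := beta_of (coefs_rec m n).
Definition c m n (k : nat) : polyS m n := c_of (coefs_rec m n) k.

(* Main.v *)
From HB Require Import structures.
Require Import Defs.
From mathcomp Require Import all_boot all_order all_algebra.
From mathcomp Require Import ring zify.

(** The proof is by induction on (m, n).  Enlarging n - 1 to n changes b^(n-1)
    and C^(m,n-1)_k only by multiples of B_n: [incl_pb_r] and [incl_pC_r] say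
    that b^(n-1) = b^(n) + b_n B_n and C^(m,n-1)_k = C^(m,n)_k - A_(k-n) B_n,
    the last term being present only for n <= k <= m + n.  Hence the identity
    for (m, n-1), read in S^(m,n), becomes
      1 = alpha^(m,n-1) a^(m) + beta^(m,n-1) b^(n)
          + sum_(k < m+n) c^(m,n-1)_k C^(m,n)_k + B_n d,
    and symmetrically the identity for (m-1, n) becomes
      1 = alpha^(m-1,n) a^(m) + beta^(m-1,n) b^(n)
          + sum_(k < m+n) c^(m-1,n)_k C^(m,n)_k + A_m e.
    Multiplying the second identity by B_n d and substituting it for the term
    B_n d of the first leaves the remainder d e A_m B_n, which is
    c^(m,n)_(m+n) C^(m,n)_(m+n). *)

Set Implicit Arguments.
Unset Strict Implicit.
Unset Printing Implicit Defensive.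

Import GRing.Theory.
Local Open Scope ring_scope.

(** * The inclusions on indeterminates *)

Section Inclusion.
Variables (m' n' m n : nat) (lem : (m' <= m)%N) (len : (n' <= n)%N).

HB.instance Definition _ := GRing.RMorphism.copy (@incl m' n' m n lem len)
  (comp_mpoly [tuple incl_var lem len x | x < (m'.+1 + n'.+1) + (m'.+1 + n'.+1)]).

Lemma inclX x : incl lem len 'X_x = incl_var lem len x.
Proof. by rewrite /incl comp_mpolyXU -tnth_nth tnth_mktuple. Qed.

Lemma incl_va i :
  incl lem len (va n' i) = va n (widen_ord (lem : m'.+1 <= m.+1)%N i).
Proof. by rewrite inclX /incl_var !(unsplitK (inl _)). Qed.

Lemma incl_vb j :
  incl lem len (vb m' j) = vb m (widen_ord (len : n'.+1 <= n.+1)%N j).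
Proof. by rewrite inclX /incl_var (unsplitK (inl _)) (unsplitK (inr _)). Qed.

Lemma incl_vA i :
  incl lem len (vA n' i) = vA n (widen_ord (lem : m'.+1 <= m.+1)%N i).
Proof. by rewrite inclX /incl_var (unsplitK (inr _)) (unsplitK (inl _)). Qed.

Lemma incl_vB j :
  incl lem len (vB m' j) = vB m (widen_ord (len : n'.+1 <= n.+1)%N j).
Proof. by rewrite inclX /incl_var !(unsplitK (inr _)). Qed.

Definition inclE := (incl_va, incl_vb, incl_vA, incl_vB).

End Inclusion.

Lemma widen_ord_id n (le_nn : (n <= n)%N) (i : 'I_n) : widen_ord le_nn i = i.
Proof. exact: val_inj. Qed.

(** * The effect of one new pair of indeterminates on a, b and C *)

Lemma incl_pa_r m n :
  incl (leqnn m) (leqnSn n) (pa m n) = pa m n.+1.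
Proof.
rewrite /pa rmorphB rmorph1 rmorph_sum; congr (_ - _); apply: eq_bigr => i _.
by rewrite rmorphM /= !inclE widen_ord_id.
Qed.

Lemma incl_pb_l m n :
  incl (leqnSn m) (leqnn n) (pb m n) = pb m.+1 n.
Proof.
rewrite /pb rmorphB rmorph1 rmorph_sum; congr (_ - _); apply: eq_bigr => i _.
by rewrite rmorphM /= !inclE widen_ord_id.
Qed.

Lemma incl_pb_r m n :
  incl (leqnn m) (leqnSn n) (pb m n)
  = pb m n.+1 + vb m ord_max * vB m ord_max.
Proof.
rewrite /pb rmorphB rmorph1 rmorph_sum [in RHS]big_ord_recr /= opprD addrA subrK.
congr (_ - _); apply: eq_bigr => i _; rewrite rmorphM /= !inclE.
by congr (vb _ _ * vB _ _); apply: val_inj.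
Qed.

Lemma incl_pa_l m n :
  incl (leqnSn m) (leqnn n) (pa m n)
  = pa m.+1 n + va n ord_max * vA n ord_max.
Proof.
rewrite /pa rmorphB rmorph1 rmorph_sum [in RHS]big_ord_recr /= opprD addrA subrK.
congr (_ - _); apply: eq_bigr => i _; rewrite rmorphM /= !inclE.
by congr (va _ _ * vA _ _); apply: val_inj.
Qed.

(** The condition i + q = k selects at most one index i <= p. *)
Lemma sum_ord_addn_eq (V : nmodType) p q k (F : 'I_p.+1 -> V) :
  \sum_(i < p.+1 | (i + q == k)%N) F i
  = if (q <= k <= p + q)%N then F (inord (k - q)) else 0.
Proof.
case: ifP => hk.
  rewrite (big_pred1 (inord (k - q))) // => i /=.
  by rewrite -val_eqE /= inordK; lia.
by rewrite big_pred0 // => i; have := ltn_ord i; lia.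
Qed.

Lemma incl_pC_r m n k :
  incl (leqnn m) (leqnSn n) (pC m n k)
  = pC m n.+1 k
    - (if (n.+1 <= k <= m + n.+1)%N
       then vA n.+1 (inord (k - n.+1)) * vB m ord_max else 0).
Proof.
rewrite -(@sum_ord_addn_eq _ m n.+1 k (fun i => vA n.+1 i * vB m ord_max)).
apply/eqP; rewrite eq_sym subr_eq /pC rmorph_sum /=; apply/eqP.
rewrite [X in _ = _ + X]big_mkcond -big_split /=; apply: eq_bigr => i _.
rewrite big_mkcond big_ord_recr /= -big_mkcond /= rmorph_sum; congr (_ + _).
apply: eq_bigr => j _; rewrite rmorphM /= !inclE widen_ord_id.
by congr (_ * vB _ _); apply: val_inj.
Qed.

Lemma incl_pC_l m n k :
  incl (leqnSn m) (leqnn n) (pC m n k)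
  = pC m.+1 n k
    - (if (m.+1 <= k <= n + m.+1)%N
       then vB m.+1 (inord (k - m.+1)) * vA n ord_max else 0).
Proof.
rewrite -(@sum_ord_addn_eq _ n m.+1 k (fun j => vB m.+1 j * vA n ord_max)).
apply/eqP; rewrite eq_sym subr_eq /pC rmorph_sum big_ord_recr /=; apply/eqP.
congr (_ + _); last by apply: eq_big => j; rewrite ?(addnC j) 1?mulrC.
apply: eq_bigr => i _; rewrite rmorph_sum; apply: eq_bigr => j _.
rewrite rmorphM /= !inclE widen_ord_id.
by congr (vA _ _ * _); apply: val_inj.
Qed.

Lemma pC_top m n : pC m n (m + n) = vA n ord_max * vB m ord_max.
Proof.
rewrite /pC (bigD1 ord_max) //= (big_pred1 ord_max) => [|j]; last first.
  by rewrite /= eqn_add2l.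
rewrite big1 ?addr0 // => i; rewrite -val_eqE /= => ne_im.
by rewrite big_pred0 // => j; have := ltn_ord i; have := ltn_ord j; lia.
Qed.

(** The correction terms of [incl_pC_r] and [incl_pC_l], summed against
    coefficients x, give the sums that occur in d and e. *)
Lemma sum_sub_ifM (R : comPzRingType) lo hi (x y z : nat -> R) (u : R) (r : nat) :
  (lo <= hi <= r.+1)%N ->
  \sum_(0 <= k < hi) x k * (y k - (if (lo <= k <= r)%N then z k * u else 0))
  = \sum_(0 <= k < hi) x k * y k - u * \sum_(lo <= k < hi) x k * z k.
Proof.
move=> /andP[le_lohi le_hir].
under eq_bigr do rewrite mulrBr.
rewrite big_split /= sumrN; congr (_ - _).
rewrite (big_cat_nat (leq0n lo) le_lohi) /= big_nat big1 ?add0r; last first.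
  by move=> k k_lt; rewrite ifF ?mulr0 //; lia.
rewrite mulr_sumr; apply: eq_big_nat => k k_lt.
by rewrite ifT; [ring | lia].
Qed.

(** * The induction *)

(** The identity to be proved, for an arbitrary triple of coefficients. *)
Definition bezout m n (X : coefs m n) : Prop :=
  1 = alpha_of X * pa m n + beta_of X * pb m n
      + \sum_(0 <= k < (m + n).+1) c_of X k * pC m n k.

Lemma bezout_0n n : bezout (coefs_0n n).
Proof.
rewrite /bezout /= /pa big_ord1 /pb /pC big_mkord add0n.
rewrite [X in _ + X](_ : _ =
  va n ord0 * vA n ord0 * \sum_(j < n.+1) vb 0 j * vB 0 j); first by ring.
rewrite mulr_sumr; apply: eq_bigr => k _; rewrite big_ord1 inord_val.
by rewrite (big_pred1 k) // ; ring.
Qed.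

Lemma bezout_m0 m : bezout (coefs_m0 m).
Proof.
rewrite /bezout /= /pb big_ord1 /pa /pC big_mkord addn0.
rewrite [X in _ + X](_ : _ =
  vb m ord0 * vB m ord0 * \sum_(i < m.+1) va 0 i * vA 0 i); first by ring.
rewrite mulr_sumr; apply: eq_bigr => k _; rewrite inord_val.
under eq_bigr do rewrite big_mkcond big_ord1 addn0.
by rewrite -big_mkcond (big_pred1 k) //; ring.
Qed.

(** The identity for (m, n) in terms of the polynomials a, b and C of
    (m, n + 1); the extra term is B_(n+1) d, with d as in the recursion. *)
Lemma bezout_incl_r m n (X : coefs m n) :
  let i := incl (leqnn m) (leqnSn n) in
  bezout X ->
  1 = i (alpha_of X) * pa m n.+1 + i (beta_of X) * pb m n.+1
      + \sum_(0 <= k < m + n.+1) i (c_of X k) * pC m n.+1 k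
      + vB m ord_max
        * (vb m ord_max * i (beta_of X)
           - \sum_(n.+1 <= k < m + n.+1)
                i (c_of X k) * vA n.+1 (inord (k - n.+1))).
Proof.
move=> /= /(congr1 (incl (leqnn m) (leqnSn n))) eqX.
rewrite rmorph1 !rmorphD !rmorphM rmorph_sum /= incl_pa_r incl_pb_r in eqX.
rewrite -addnS in eqX; rewrite [LHS]eqX.
under [X in _ + _ + X = _]eq_bigr do rewrite rmorphM /= incl_pC_r.
by rewrite sum_sub_ifM; [ring | lia].
Qed.

(** The same for (m + 1, n), with extra term A_(m+1) e. *)
Lemma bezout_incl_l m n (Y : coefs m n) :
  let i := incl (leqnSn m) (leqnn n) in
  bezout Y ->
  1 = i (alpha_of Y) * pa m.+1 n + i (beta_of Y) * pb m.+1 n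
      + \sum_(0 <= k < m.+1 + n) i (c_of Y k) * pC m.+1 n k
      + vA n ord_max
        * (va n ord_max * i (alpha_of Y)
           - \sum_(m.+1 <= k < m.+1 + n)
                i (c_of Y k) * vB m.+1 (inord (k - m.+1))).
Proof.
move=> /= /(congr1 (incl (leqnSn m) (leqnn n))) eqY.
rewrite rmorph1 !rmorphD !rmorphM rmorph_sum /= incl_pa_l incl_pb_l in eqY.
rewrite -addSn in eqY; rewrite [LHS]eqY.
under [X in _ + _ + X = _]eq_bigr do rewrite rmorphM /= incl_pC_l.
by rewrite sum_sub_ifM; [ring | lia].
Qed.

Lemma bezout_step m n (X : coefs m.+1 n) (Y : coefs m n.+1) :
  bezout X -> bezout Y -> bezout (coefs_step X Y).
Proof.
move=> /bezout_incl_r /= eqX /bezout_incl_l /= eqY; rewrite /bezout /=.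
set d := vb m.+1 ord_max * _ - _; set e := va n.+1 ord_max * _ - _.
rewrite -/d in eqX; rewrite -/e in eqY.
rewrite [X in _ + X]big_nat_recr // ltnn pC_top.
under [X in _ + (X + _)]eq_big_nat => k k_lt do
  rewrite (_ : (k < m.+1 + n.+1)%N = true) // mulrDl -[_ * _ * _ * _]mulrA.
rewrite big_split /= -mulr_sumr.
(* In B_n d = B_n d * 1, the factor 1 is expanded by the second identity. *)
by rewrite [LHS]eqX -[X in _ + X = _]mulr1 [X in _ + _ * X = _]eqY; ring.
Qed.

Theorem proposition3 (m n : nat) :
  1 = alpha m n * pa m n + beta m n * pb m n
      + \sum_(0 <= k < (m + n).+1) c m n k * pC m n k :> polyS m n.
Proof.
suff: bezout (coefs_rec m n) by [].
elim: m n => [|m IHm] n; first exact: bezout_0n.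
elim: n => [|n IHn]; first exact: bezout_m0.
exact: bezout_step.
Qed.
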